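(* Let $(N_t)_{t\in\mathbb{R}_+}$ be a standard Poisson process with intensity $\lambda>0$ and jump times $(T_k)_{k\ge 1}$, and let $(U_k)_{k\ge 1}$ be an i.i.d. sequence of random variables uniformly distributed on $[0,1]$, independent of $(N_t)_{t\in\mathbb{R}_+}$. Define the growth-collapse process $$X_t = t-\sum_{k=1}^{N_t} T_k(1-U_k)\prod_{l=k+1}^{N_t}U_l,\qquad t\in\mathbb{R}_+ .$$ Then for all integers $n\ge 0$ and all $t\in\mathbb{R}_+$, $$\mathbb{E}[(X_t)^n]=\frac{(n+1)!}{\lambda^n}\sum_{k=0}^n(-1)^k(k+1)^{n-1}\binom{n}{k}\mathrm{e}^{-k\lambda t/(k+1)} .$$ As a consequence, for all $n\ge 1$, $$\lim_{t\to\infty}\mathbb{E}[(X_t)^n]=\frac{(n+1)!}{\lambda^n}.$$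
   Context: Empty products equal $1$ and empty sums equal $0$; $(X_t)^0=1$. *)

(* Defs.v *)
From HB Require Import structures.
From mathcomp Require Import all_boot all_order all_algebra finmap.
From mathcomp Require Import all_classical all_reals all_analysis.

Set Implicit Arguments.
Unset Strict Implicit.
Unset Printing Implicit Defensive.

Import Order.TTheory GRing.Theory Num.Theory.
Import numFieldNormedType.Exports.

Local Open Scope classical_set_scope.
Local Open Scope ring_scope.

Definition mutually_independent d (Omega : measurableType d) (R : realType)
    (P : probability Omega R) d' (E : measurableType d') (I : choiceType)
    (D : set I) (X : I -> Omega -> E) : Prop :=
  forall J : {fset I}, [set` J] `<=` D ->
  forall A : I -> set E, (forall i, i \in J -> measurable (A i)) ->
    P (\bigcap_(i in [set` J]) (X i @^-1` A i)) =
    (\prod_(i <- J) P (X i @^-1` A i))%E.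

Definition sigma_family (Omega : Type) d (E : measurableType d) (I : Type)
    (D : set I) (X : I -> Omega -> E) : set (set Omega) :=
  <<s \bigcup_(i in D) preimage_set_system setT (X i) measurable >>.

Definition independent_families d (Omega : measurableType d) (R : realType)
    (P : probability Omega R)
    d1 (E1 : measurableType d1) (I1 : Type) (D1 : set I1)
    (X : I1 -> Omega -> E1)
    d2 (E2 : measurableType d2) (I2 : Type) (D2 : set I2)
    (Y : I2 -> Omega -> E2) : Prop :=
  forall A B : set Omega, sigma_family D1 X A -> sigma_family D2 Y B ->
    P (A `&` B) = (P A * P B)%E.

(* Sequences written (T_k)_{k >= 1} on paper are indexed by all of nat; the
   entry of index 0, like N t for t < 0, is never constrained nor used. *)

(* N_t = sum_(k >= 1) 1_[T_k, oo[(t).  The sum is taken in \bar R, so that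
   its equality with a natural number forces only finitely many jumps to occur
   before t (no explosion). *)
Definition counting_process d (Omega : measurableType d) (R : realType)
    (P : probability Omega R) (N : R -> {RV P >-> nat})
    (T : nat -> {RV P >-> R}) : Prop :=
  {ae P, forall w,
    [/\ 0 < T 1%N w,
        forall k, (1 <= k)%N -> T k w < T k.+1 w
      & forall t, 0 <= t ->
        (((N t w)%:R : R)%:E =
         \sum_(1 <= k <oo) (\1_(`[T k w, +oo[) t)%:E)%E]}.

(* Paths are almost surely nondecreasing, so the truncated subtraction of nat
   is the genuine increment. *)
Definition increment d (Omega : measurableType d) (R : realType)
    (P : probability Omega R) (N : R -> {RV P >-> nat}) (s t : R) (w : Omega)
    : nat :=
  (N t w - N s w)%N.

Definition independent_increments d (Omega : measurableType d) (R : realType)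
    (P : probability Omega R) (N : R -> {RV P >-> nat}) : Prop :=
  forall (n : nat) (t : nat -> R), 0 <= t 0%N ->
    (forall i, (i < n)%N -> t i < t i.+1) ->
    mutually_independent P [set i | (i < n)%N]
      (fun i => increment N (t i) (t i.+1)).

Definition poisson_increments d (Omega : measurableType d) (R : realType)
    (P : probability Omega R) (lambda : R) (N : R -> {RV P >-> nat}) : Prop :=
  forall s t : R, 0 <= s -> s < t -> forall k : nat,
    P [set w | increment N s t w = k] =
    (poisson_pmf (lambda * (t - s)) k)%:E.

Definition poisson_process d (Omega : measurableType d) (R : realType)
    (P : probability Omega R) (lambda : R) (N : R -> {RV P >-> nat})
    (T : nat -> {RV P >-> R}) : Prop :=
  [/\ counting_process N T, independent_increments N
    & poisson_increments lambda N].

Definition iid_uniform01 d (Omega : measurableType d) (R : realType)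
    (P : probability Omega R) (U : nat -> {RV P >-> R}) : Prop :=
  mutually_independent P [set k | (1 <= k)%N] (fun k => U k : Omega -> R) /\
  forall k, (1 <= k)%N -> forall A : set R, measurable A ->
    distribution P (U k) A = uniform_prob (@ltr01 R) A.

Definition growth_collapse d (Omega : measurableType d) (R : realType)
    (P : probability Omega R) (N : R -> {RV P >-> nat})
    (T U : nat -> {RV P >-> R}) (t : R) (w : Omega) : R :=
  t - \sum_(1 <= k < (N t w).+1)
        T k w * (1 - U k w) * \prod_(k.+1 <= l < (N t w).+1) U l w.

(* Main.v *)
(*
X grows with slope 1 and is multiplied by U_k at T_k. Rounding every jump time
down to a grid of step h = t / m gives a process Y with |X - Y| <= h and
Y_(i+1) = h + V_i Y_i, where V_i is the product of the U_l over the jumps in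
]ih, (i+1)h]. The V_i have independent moments
E[V_i^j] = exp (- lambda h j / (j + 1)), so the moments y_i(n) = E[Y_i^n] obey
  y_(i+1)(n) = sum_(j <= n) C(n, j) h^(n - j) exp (- lambda h j / (j + 1)) y_i(j),
which is an Euler scheme for f_n' = n f_(n-1) - lambda n / (n + 1) f_n,
f_n(0) = [n = 0]. The right-hand sides of the statement solve this system (the
initial condition is the vanishing of an n-th finite difference of a polynomial
of degree n - 1), and the scheme converges as m goes to infinity.
*)
Require Import Defs.
From HB Require Import structures.
From mathcomp Require Import all_boot all_order all_algebra finmap.
From mathcomp Require Import all_classical all_reals all_analysis.
From mathcomp Require Import measurable_realfun ring lra.

Set Implicit Arguments.
Unset Strict Implicit.
Unset Printing Implicit Defensive.

Import Order.TTheory GRing.Theory Num.Theory.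
Import numFieldNormedType.Exports.

Local Open Scope classical_set_scope.
Local Open Scope ring_scope.

(** * Alternating binomial sums *)

(** Pascal's rule turns an alternating sum of order n + 1 into one of order n over the differences F
    k - F (k + 1). For powers of k + 1 these differences have lower degree, and induction
    applies. *)
Lemma alternating_binomial_power_sum (R : comNzRingType) (n j : nat) :
  (j < n)%N ->
  \sum_(k < n.+1) (-1) ^+ k * 'C(n, k)%:R * (k.+1%:R : R) ^+ j = 0.
Proof.
elim: n j => // n IHn j ltjn.
have shift (F : nat -> R) :
    \sum_(k < n.+2) (-1) ^+ k * 'C(n.+1, k)%:R * F k =
    \sum_(k < n.+1) (-1) ^+ k * 'C(n, k)%:R * (F k - F k.+1).
  rewrite big_ord_recl /= bin0 mul1r mul1r.
  under eq_bigr do rewrite /bump /= add1n binS natrD mulrDr mulrDl.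
  rewrite big_split /= addrA [X in F _ + X]big_ord_recr /=.
  rewrite bin_small // mulr0 mul0r addr0.
  rewrite (_ : F 0%N + _ = \sum_(k < n.+1) (-1) ^+ k * 'C(n, k)%:R * F k).
    rewrite -big_split; apply: eq_bigr => k _ /=.
    by rewrite exprS; ring.
  by rewrite [RHS]big_ord_recl /= bin0 mul1r mul1r.
rewrite (shift (fun k => k.+1%:R ^+ j)).
rewrite (eq_bigr (fun k : 'I_n.+1 => - \sum_(i < j)
    'C(j, i)%:R * ((-1) ^+ k * 'C(n, k)%:R * (k.+1%:R : R) ^+ i))); last first.
  move=> k _; have -> : k.+2%:R = 1 + k.+1%:R :> R by rewrite -[k.+2%:R]natr1 addrC.
  rewrite exprDn big_ord_recr /= subnn expr0 mul1r binn mulr1n opprD addrCA.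
  rewrite subrr addr0 mulrN mulr_sumr; congr (- _); apply: eq_bigr => i _.
  by rewrite expr1n mul1r -mulr_natr; ring.
rewrite sumrN exchange_big /= big1 ?oppr0 // => i _.
by rewrite -mulr_sumr IHn ?mulr0 // (leq_trans (ltn_ord i)).
Qed.

(** * The differential system of the moments and its Euler scheme *)

Section euler_scheme.
Context {R : realType} (lambda : R).
Hypothesis lambda_gt0 : 0 < lambda.

(** Jumps occur at rate [lambda] and multiply the [j]-th power by a factor of mean 1 / (j + 1),
    whence the loss rate lambda (1 - 1 / (j + 1)). *)
Definition decay (j : nat) : R := lambda * j%:R / j.+1%:R.

(** The exponent of k + 1 is taken in the integers because it equals -1 for [n = 0]. *)
Definition moment (n : nat) (t : R) : R :=
  (n.+1)`!%:R / lambda ^+ n *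
  \sum_(0 <= k < n.+1)
    (-1) ^+ k * (k.+1%:R : R) ^ (n%:Z - 1) * 'C(n, k)%:R *
    expR (- (k%:R * lambda * t / k.+1%:R)).

Let coef (n k : nat) : R := (n.+1)`!%:R / lambda ^+ n *
  ((-1) ^+ k * (k.+1%:R : R) ^ (n%:Z - 1) * 'C(n, k)%:R).

Lemma decay_ge0 j : 0 <= decay j.
Proof. by rewrite divr_ge0 // mulr_ge0 // ltW. Qed.

Lemma decay_le j : decay j <= lambda.
Proof.
rewrite /decay ler_pdivrMr ?ltr0n //; apply: ler_wpM2l; first exact: ltW.
by rewrite ler_nat.
Qed.

Let momentE n t : moment n t = \sum_(k < n.+1) coef n k * expR (- (decay k * t)).
Proof.
rewrite /moment big_mkord mulr_sumr; apply: eq_bigr => k _.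
rewrite mulrA; congr (_ * expR (- _)); rewrite /decay; ring.
Qed.

(* Matches the exponential coefficients in the differential equation
   f_(n+1)' = (n+1) f_n - decay (n+1) f_(n+1). *)
Let coefS n k : (k < n.+2)%N ->
  coef n.+1 k * (decay n.+1 - decay k) =
  if (k < n.+1)%N then n.+1%:R * coef n k else 0.
Proof.
move=> lek; have k0 : k.+1%:R != 0 :> R by rewrite pnatr_eq0.
have n0 : n.+2%:R != 0 :> R by rewrite pnatr_eq0.
case: ifPn => [ltkn|]; last first.
  rewrite -leqNgt => ltnk.
  have -> : k = n.+1 by apply/eqP; rewrite eqn_leq ltnk -ltnS lek.
  by rewrite subrr mulr0.
have l0 : lambda != 0 by rewrite gt_eqF.
have l0n : lambda ^+ n != 0 by rewrite expf_neq0.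
have -> : decay n.+1 - decay k = lambda * (n.+1 - k)%:R / (n.+2%:R * k.+1%:R).
  have -> : (n.+1 - k)%:R = n.+2%:R - k.+1%:R :> R.
    by rewrite -natrB; [rewrite subSS | exact: ltnW].
  have decayE j : decay j = lambda * (j.+1%:R - 1) / j.+1%:R.
    by rewrite /decay -[j.+1%:R in X in _ = X * _]natr1 addrK.
  have alg (l x y : R) : x != 0 -> y != 0 ->
      l * (x - 1) / x - l * (y - 1) / y = l * (x - y) / (x * y).
    by move=> x0 y0; field; rewrite x0 y0.
  by rewrite !decayE alg.
have binE : 'C(n.+1, k)%:R * (n.+1 - k)%:R = n.+1%:R * 'C(n, k)%:R :> R.
  by rewrite -!natrM; congr (_%:R); rewrite [LHS]mulnC -[LHS]mul_bin_down.
have powE : (k.+1%:R : R) ^ (n.+1%:Z - 1) = k.+1%:R ^ (n%:Z - 1) * k.+1%:R.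
  by rewrite (_ : n.+1%:Z - 1 = (n%:Z - 1) + 1) ?expfzDr ?expr1z // intS; ring.
(* Over abstract variables, [field] treats the factorials, powers and binomials as atoms. *)
have alg (c x y z u l b e s : R) : x != 0 -> y != 0 -> z != 0 -> l != 0 ->
    x * c / (l * z) * (s * (u * y) * b) * (l * e / (x * y)) = c / z * s * u * (b * e).
  by move=> x0 y0 z0 l'0; field; rewrite x0 y0 z0 l'0.
by rewrite /coef powE factS natrM exprS alg // binE; ring.
Qed.

Lemma moment0 t : moment 0 t = 1.
Proof.
rewrite /moment big_mkord big_ord_recl big_ord0 /= expr0 addr0 !mul0r oppr0.
by rewrite expR0 bin0 !mulr1 expr0 invr1 exp1rz !mulr1.
Qed.

(** At time 0 the exponentials are 1, leaving the alternating sum of order n + 1 of [n]-th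
    powers. *)
Lemma momentS0 n : moment n.+1 0 = 0.
Proof.
rewrite /moment big_mkord.
under eq_bigr => k _.
  rewrite mulr0 mul0r oppr0 expR0 mulr1 intS addrAC subrr add0r mulrAC.
  over.
by rewrite (alternating_binomial_power_sum R (ltnSn n)) mulr0.
Qed.

(** For the upper bound, exp(x) >= 1 + x gives exp(-x) <= 1 / (1 + x), hence exp(-x) - 1 + x <= x^2
    / (1 + x). *)
Let expRN_taylor (x : R) : 0 <= x -> `|expR (- x) - 1 + x| <= x ^+ 2.
Proof.
move=> x0; have lo := expR_ge1Dx (- x); rewrite ger0_norm; last lra.
have hi : expR (- x) * (1 + x) <= 1.
  have e0 := expR_gt0 (- x).
  have e1 : expR (- x) * expR x = 1 by rewrite -expRD addNr expR0.
  by rewrite -[leRHS]e1 ler_pM2l // expR_ge1Dx.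
have e0 := expR_gt0 (- x); nra.
Qed.

(** Local error of an Euler step in which the decay is solved exactly. By [coefS] the terms of first
    order in [h] cancel; [K] is uniform in [s] because every factor exp(- decay k * s) is at most
    1. *)
Let moment_local n : exists2 K, 0 <= K & forall s h, 0 <= s -> 0 <= h ->
  `|moment n.+1 (s + h) - expR (- (decay n.+1 * h)) * moment n.+1 s
    - n.+1%:R * h * moment n s| <= K * h ^+ 2.
Proof.
exists (\sum_(k < n.+2) `|coef n.+1 k| * (decay k ^+ 2 + decay n.+1 ^+ 2)).
  by apply: sumr_ge0 => k _; rewrite mulr_ge0 // addr_ge0 // sqr_ge0.
move=> s h s0 h0.
(* By [coefS] the term k = n + 1 is zero, so the sum can run over the same indices as that of
   [moment n.+1]. *)
have -> : n.+1%:R * h * moment n s =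
    \sum_(k < n.+2) coef n.+1 k * (decay n.+1 - decay k) * h * expR (- (decay k * s)).
  rewrite big_ord_recr /= coefS // ltnn !mul0r addr0 momentE mulr_sumr.
  by apply: eq_bigr => k _; rewrite coefS ?ltn_ord // 1?ltnS 1?ltnW //; ring.
rewrite !momentE mulr_sumr -!sumrB mulr_suml.
apply: le_trans (ler_norm_sum _ _ _) _; apply: ler_sum => k _.
have -> : expR (- (decay k * (s + h))) = expR (- (decay k * s)) * expR (- (decay k * h)).
  by rewrite -expRD mulrDr opprD.
set a := decay k; set b := decay n.+1; set c := coef _ _.
(* The two brackets are the remainders controlled by [expRN_taylor]. *)
rewrite (_ : _ - _ = c * (expR (- (a * s)) * ((expR (- (a * h)) - 1 + a * h) -
  (expR (- (b * h)) - 1 + b * h)))); last by ring.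
rewrite normrM -[leRHS]mulrA; apply: ler_wpM2l => //; rewrite normrM.
rewrite ger0_norm ?expR_ge0 //.
have e1 : expR (- (a * s)) <= 1 by rewrite expR_le1 oppr_le0 mulr_ge0 ?decay_ge0.
have e0 := expR_ge0 (- (a * s)).
apply: (@le_trans _ _ (1 * (`|expR (- (a * h)) - 1 + a * h| +
                            `|expR (- (b * h)) - 1 + b * h|))).
  by apply: ler_pM => //; exact: ler_normB.
rewrite mul1r mulrDl -!exprMn.
by apply: lerD; apply: expRN_taylor; rewrite mulr_ge0 ?decay_ge0.
Qed.

(* Meant to be [E(Y_i ^ n)], see [integral_discrete_growth_mixed]. *)
Fixpoint moment_scheme (h : R) (i n : nat) : R :=
  if i is i'.+1 then
    \sum_(j < n.+1) 'C(n, j)%:R * h ^+ (n - j) * expR (- (decay j * h)) *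
                    moment_scheme h i' j
  else (n == 0%N)%:R.

(** The decay factors are at most 1; without them the recursion is the binomial expansion of (i h +
    h)^n. *)
Lemma moment_scheme_bounds h i n : 0 <= h ->
  0 <= moment_scheme h i n <= (i%:R * h) ^+ n.
Proof.
move=> h0; elim: i n => [|i IHi] n /=.
  by rewrite mul0r expr0n ler0n lexx.
apply/andP; split.
  apply: sumr_ge0 => j _; have /andP[? _] := IHi j.
  by rewrite !mulr_ge0 ?ler0n ?exprn_ge0 ?expR_ge0.
rewrite -natr1 mulrDl mul1r addrC exprDn; apply: ler_sum => j _.
have /andP[lo hi] := IHi j.
rewrite -[leRHS]mulr_natl mulrA ler_pM ?mulr_ge0 ?ler0n ?exprn_ge0 ?expR_ge0 //.
rewrite ler_piMr ?mulr_ge0 ?ler0n ?exprn_ge0 //.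
by rewrite expR_le1 oppr_le0 mulr_ge0 ?decay_ge0.
Qed.

(** Induction on [n]: the recursion for order n + 1 sees order n with a factor [h] and lower orders
    with a factor [h ^+ 2], so one step adds an error O(1 / m^2) and at most m steps cost O(1 /
    m). *)
Lemma moment_scheme_cvg (t : R) (n : nat) : 0 <= t ->
  exists2 C, 0 <= C & forall m i, (0 < m)%N -> (i <= m)%N ->
    `|moment_scheme (t / m%:R) i n - moment n (i%:R * (t / m%:R))| <= C / m%:R.
Proof.
move=> t0; elim: n => [|n [C C0 IH]].
  exists 0 => // m i m0 _; rewrite moment0 mul0r normr_le0 subr_eq0; apply/eqP.
  elim: i => //= i IHi; rewrite big_ord_recl big_ord0 /= bin0 subnn expr0 IHi.
  by rewrite /decay mulr0 !mul0r oppr0 expR0 addr0 !mulr1.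
have [K K0 locK] := moment_local n.
(* Bounds the orders [j < n], whose factor h^(n + 1 - j) contains h^2; the surplus powers of [h] are
   controlled by [h <= t]. *)
pose B := \sum_(j < n) 'C(n.+1, j)%:R * t ^+ (n.-1 - j) * t ^+ j.
have B0 : 0 <= B by apply: sumr_ge0 => j _; rewrite !mulr_ge0 ?ler0n ?exprn_ge0.
(* L / m^2 bounds the error added by one step: the local error, the error inherited from order n
   together with the cost of replacing exp(- decay n * h) by 1, and the lower orders. *)
pose L := K * t ^+ 2 + n.+1%:R * t * (C + lambda * t * t ^+ n) + B * t ^+ 2.
have L0 : 0 <= L.
  rewrite /L !addr_ge0 ?mulr_ge0 ?sqr_ge0 ?addr_ge0 ?mulr_ge0 ?exprn_ge0 //.
  exact: ltW.
exists L => // m i m0 im.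
have mR : 0 < m%:R :> R by rewrite ltr0n.
have m1 : m%:R^-1 <= 1 :> R by rewrite invf_le1 // ler1n.
suff step : forall i, (i <= m)%N ->
    `|moment_scheme (t / m%:R) i n.+1 - moment n.+1 (i%:R * (t / m%:R))| <=
    i%:R * (L / m%:R ^+ 2).
  apply: le_trans (step i im) _.
  have -> : i%:R * (L / m%:R ^+ 2) = (i%:R / m%:R) * (L / m%:R).
    by rewrite expr2 invfM; ring.
  rewrite ler_piMl ?divr_ge0 ?(ltW mR) // ler_pdivrMr // mul1r ler_nat //.
move=> {im}; elim=> [_|{}i IHi im].
  by rewrite !mul0r momentS0 /= subrr normr0.
have {}IHi := IHi (ltnW im).
set h := t / m%:R in IHi *; set s := i%:R * h in IHi *.
have h0 : 0 <= h by rewrite divr_ge0 // ltW.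
have ht : h <= t by rewrite ler_piMr.
have s0 : 0 <= s by rewrite mulr_ge0.
have st : s <= t.
  rewrite /s /h mulrCA ler_piMr // ler_pdivrMr // mul1r ler_nat; exact: ltnW.
have -> : i.+1%:R * h = s + h by rewrite -natr1 mulrDl mul1r.
have y0 j : 0 <= moment_scheme h i j by have /andP[] := moment_scheme_bounds i j h0.
have yt j : moment_scheme h i j <= t ^+ j.
  have /andP[_ /le_trans] := moment_scheme_bounds i j h0; apply.
  by rewrite lerXn2r ?nnegrE.
have IHn := IH m i m0 (ltnW im); rewrite -/h -/s in IHn.
have locs := locK s h s0 h0.
rewrite [moment_scheme _ _.+1 _]/= big_ord_recr big_ord_recr /=.
rewrite subnn expr0 binn subSnn expr1 binSn.
set S := \sum_(j < n) _.
have S0 : 0 <= S.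
  by apply: sumr_ge0 => j _; rewrite !mulr_ge0 ?ler0n ?exprn_ge0 ?expR_ge0.
have SB : S <= B * h ^+ 2.
  rewrite mulr_suml; apply: ler_sum => j _.
  have -> : (n.+1 - j = 2 + (n.-1 - j))%N.
    by move: (nat_of_ord j) (ltn_ord j); case: (n) => // n' j' ?; rewrite !subSn // ltnW.
  rewrite exprD; set E := expR _.
  have E1 : E <= 1 by rewrite expR_le1 oppr_le0 mulr_ge0 ?decay_ge0.
  have E0 : 0 <= E := expR_ge0 _.
  rewrite (_ : _ * _ * E * _ = 'C(n.+1, j)%:R *
    (h ^+ 2 * (h ^+ (n.-1 - j) * (E * moment_scheme h i j)))); last by ring.
  rewrite (_ : _ * t ^+ j * h ^+ 2 = 'C(n.+1, j)%:R *
    (h ^+ 2 * (t ^+ (n.-1 - j) * t ^+ j))); last by ring.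
  rewrite ler_wpM2l // ler_wpM2l ?sqr_ge0 //; apply: ler_pM; rewrite ?exprn_ge0 ?mulr_ge0 //.
    by rewrite lerXn2r ?nnegrE.
  by apply: le_trans (yt j); rewrite ler_piMl.
set q := expR (- (decay n.+1 * h)) in locs *.
have q0 : 0 <= q := expR_ge0 _.
have q1 : q <= 1 by rewrite expR_le1 oppr_le0 mulr_ge0 ?decay_ge0.
set p := expR (- (decay n * h)).
have p1 : 1 - p <= lambda * h.
  have := expR_ge1Dx (- (decay n * h)); rewrite -/p => ?.
  have := ler_wpM2r h0 (decay_le n); lra.
have p1' : 0 <= 1 - p by rewrite subr_ge0 expR_le1 oppr_le0 mulr_ge0 ?decay_ge0.
(* The old error is multiplied by [q <= 1], so errors merely add up and no Gronwall factor
   appears. *)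
rewrite (_ : _ - _ = q * (moment_scheme h i n.+1 - moment n.+1 s) -
  (moment n.+1 (s + h) - q * moment n.+1 s - n.+1%:R * h * moment n s) +
  n.+1%:R * h * ((moment_scheme h i n - moment n s) - (1 - p) * moment_scheme h i n)
  + S); last by rewrite /q /p; ring.
apply: le_trans (ler_normD _ _) _; rewrite (ger0_norm S0).
have -> : i.+1%:R * (L / m%:R ^+ 2) = i%:R * (L / m%:R ^+ 2) + K * h ^+ 2 +
   n.+1%:R * h * (C / m%:R + lambda * h * t ^+ n) + B * h ^+ 2.
  by rewrite /L /h -[i.+1%:R]natr1; field; rewrite gt_eqF.
apply: lerD => //; apply: le_trans (ler_normD _ _) _; apply: lerD.
  apply: le_trans (ler_normB _ _) _; apply: lerD => //.
  by apply: le_trans IHi; rewrite normrM (ger0_norm q0) ler_piMl.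
rewrite normrM (@ger0_norm _ (n.+1%:R * h)) ?mulr_ge0 //.
apply: ler_wpM2l; first by rewrite mulr_ge0.
apply: le_trans (ler_normB _ _) _; apply: lerD => //.
by rewrite ger0_norm ?mulr_ge0 // ler_pM.
Qed.

End euler_scheme.

(** * Pathwise comparison with the discretized process *)

Definition collapse (R : realType) (c : nat -> nat) (U : nat -> R) (i : nat) : R :=
  \prod_((c i).+1 <= l < (c i.+1).+1) U l.

(** Here [c] counts the jumps up to each grid time. Jumps of a cell are moved to its left end, so
    the collapse precedes the growth by [h]. *)
Fixpoint discrete_growth (R : realType) (h : R) (c : nat -> nat) (U : nat -> R)
    (i : nat) : R :=
  if i is i'.+1 then h + collapse c U i' * discrete_growth h c U i' else 0.

Section pathwise.
Context {R : realType} (N : R -> nat) (T U : nat -> R).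
Hypothesis U01 : forall k, 0 <= U k <= 1.
Hypothesis T1_gt0 : 0 < T 1%N.
Hypothesis countE : forall t k, 0 <= t -> (1 <= k)%N -> (k <= N t)%N = (T k <= t).

Lemma counting_mono s t : 0 <= s -> s <= t -> (N s <= N t)%N.
Proof.
move=> s0 st; case: (posnP (N s)) => [->//|Ns].
rewrite countE //; last exact: le_trans st.
by apply: le_trans st; rewrite -countE.
Qed.

Lemma counting_at0 : N 0 = 0%N.
Proof.
apply/eqP; rewrite -leqn0 leqNgt countE //.
by rewrite -ltNge.
Qed.

Lemma prod_bounds m n : 0 <= \prod_(m <= l < n) U l <= 1.
Proof.
rewrite prodr_ge0 /=; last by move=> l _; case/andP: (U01 l).
by rewrite prodr_ile1 // => l _; exact: U01.
Qed.

(** Each term is the product over l > k minus the product over l >= k. *)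
Lemma telescope_collapse m n : (m <= n)%N ->
  \sum_(m.+1 <= k < n.+1) (1 - U k) * \prod_(k.+1 <= l < n.+1) U l =
  1 - \prod_(m.+1 <= l < n.+1) U l.
Proof.
elim: n => [|n IHn]; first by rewrite leqn0 => /eqP->; rewrite !big_geq // subrr.
rewrite leq_eqVlt => /predU1P[->|]; first by rewrite !big_geq // subrr.
rewrite ltnS => mn; rewrite big_nat_recr ?ltnS //= [X in _ + _ * X]big_geq //.
rewrite (eq_big_nat _ _
  (F2 := fun k => (1 - U k) * \prod_(k.+1 <= l < n.+1) U l * U n.+1)).
  rewrite -mulr_suml IHn // [in RHS]big_nat_recr ?ltnS //=; ring.
move=> k /andP[_ kn]; rewrite [in LHS]big_nat_recr //=; ring.
Qed.

(** The new jump times of a cell lie between s and s + h, so by [telescope_collapse] their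
    contribution lies between s (1 - V) and (s + h) (1 - V). The old gap is multiplied by V and at
    most h (1 - V) is added, so the gap never exceeds h. *)
Lemma discrete_growth_approx (h : R) (i : nat) : 0 <= h ->
  discrete_growth h (fun j => N (j%:R * h)) U i - h
  <= i%:R * h - \sum_(1 <= k < (N (i%:R * h)).+1)
       T k * (1 - U k) * \prod_(k.+1 <= l < (N (i%:R * h)).+1) U l
  <= discrete_growth h (fun j => N (j%:R * h)) U i.
Proof.
move=> h0; elim: i => [|i IHi].
  by rewrite mul0r counting_at0 big_geq //= !subr0 sub0r oppr_le0 h0 lexx.
set s := i%:R * h in IHi *; set c := fun j => N _ in IHi *.
have -> : i.+1%:R * h = s + h by rewrite -natr1 mulrDl mul1r.
have s0 : 0 <= s by rewrite mulr_ge0.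
have cS : c i.+1 = N (s + h) by rewrite /c -natr1 mulrDl mul1r.
have mono : (N s <= N (s + h))%N by rewrite counting_mono // lerDl.
rewrite /= /collapse cS -/s; set V := \prod_(_ <= l < _) U l.
have /andP[V0 V1] : 0 <= V <= 1 := prod_bounds _ _.
move: IHi; set Y := discrete_growth _ _ _ _; set S := \sum_(_ <= k < _) _ => IHi.
rewrite (big_cat_nat _ (n := (N s).+1)) //=.
(* Every earlier jump also receives the collapse factor [V] of the new cell. *)
rewrite [X in _ - (X + _)](_ : _ = S * V); last first.
  rewrite /S mulr_suml; apply: eq_big_nat => k /andP[_ kN].
  by rewrite -!mulrA -big_cat_nat.
have tele := telescope_collapse mono; rewrite -/V in tele.
have W0 k : 0 <= (1 - U k) * \prod_(k.+1 <= l < (N (s + h)).+1) U l.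
  by apply: mulr_ge0; [case/andP: (U01 k); lra | case/andP: (prod_bounds k.+1 (N (s + h)).+1)].
set S' := \sum_(_ <= k < _) _.
have lo : s * (1 - V) <= S'.
  rewrite -tele mulr_sumr; apply: ler_sum_nat => k /andP[Nk _].
  rewrite -[leRHS]mulrA ler_wpM2r // ltW // ltNge -countE ?(leq_ltn_trans _ Nk) //.
  by rewrite -ltnNge.
have hi : S' <= (s + h) * (1 - V).
  rewrite -tele mulr_sumr; apply: ler_sum_nat => k /andP[Nk kN].
  by rewrite -[leLHS]mulrA ler_wpM2r // -countE ?(leq_ltn_trans _ Nk) ?addr_ge0.
case/andP: IHi => i1 i2.
have := ler_wpM2l V0 i1; have := ler_wpM2l V0 i2; nra.
Qed.

End pathwise.

(** * Random indices and independent factors *)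

(** The preimage is a countable union over the values of [M]. This serves for sums and products with
    random bounds. *)
Lemma measurable_nat_index d (Om : measurableType d) d' (E : measurableType d')
    (g : nat -> Om -> E) (M : Om -> nat) :
  measurable_fun setT M -> (forall n, measurable_fun setT (g n)) ->
  measurable_fun setT (fun w => g (M w) w).
Proof.
move=> mM mg _ B mB; rewrite setTI.
have -> : (fun w => g (M w) w) @^-1` B =
    \bigcup_n ((M @^-1` [set n]) `&` (g n @^-1` B)).
  by apply/seteqP; split=> [w /= ?|w [n _ [/= <-]]//]; exists (M w).
apply: bigcup_measurable => n _; apply: measurableI.
  by rewrite -[X in measurable X]setTI; exact: mM.
by rewrite -[X in measurable X]setTI; exact: mg.
Qed.

Section independent_factor.
Local Open Scope ereal_scope.
Context d (Om : measurableType d) (R : realType) (P : probability Om R).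
Context d' (E : measurableType d') (mu : probability E R).
Variables (Z : Om -> R) (V : Om -> E) (C : R).
Hypotheses (mZ : measurable_fun setT Z) (Z0 : forall w, (0 <= Z w)%R).
Hypothesis mV : measurable_fun setT V.
Hypothesis ZV : forall B, measurable B ->
  \int[P]_w (Z w * \1_B (V w))%:E = C%:E * mu B.

Import HBNNSimple.

Let factor_nnsfun (f : {nnsfun E >-> R}) :
  \int[P]_w (Z w * f (V w))%:E = C%:E * \int[mu]_x (f x)%:E.
Proof.
transitivity (\int[P]_w (\sum_(r \in range f)
  (r * (Z w * \1_(f @^-1` [set r]) (V w)))%:E)).
  apply: eq_integral => w _; rewrite fimfunE.
  rewrite fsumEFin // fsbig_finite //= [in RHS]fsbig_finite //= mulr_sumr.
  by congr _%:E; apply: eq_bigr => r _; ring.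
have mpre r : measurable (f @^-1` [set r]) by [].
have mI r : measurable_fun setT (fun w => Z w * \1_(f @^-1` [set r]) (V w))%R.
  by apply: measurable_funM => //; exact: (measurableT_comp (measurable_indic _)).
rewrite ge0_integral_fsum //; last 2 first.
- by move=> r; apply/measurable_EFinP; exact: measurable_funM.
- move=> r w _; rewrite mulrCA lee_fin mulr_ge0 //.
  by have := nnfun_muleindic_ge0 f r (V w); rewrite lee_fin.
under [in RHS]eq_integral do rewrite fimfunE -fsumEFin//.
rewrite [in RHS]ge0_integral_fsum //; last 2 first.
- by move=> r; exact/measurable_EFinP/measurableT_comp.
- by move=> r x _; rewrite EFinM nnfun_muleindic_ge0.
rewrite ge0_mule_fsumr; last first.
  by move=> r; apply: integral_ge0 => x _; rewrite EFinM nnfun_muleindic_ge0.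
apply: eq_fsbigr => r /[!inE] -[x _ <-].
under eq_integral do rewrite EFinM.
rewrite ge0_integralZl_EFin //; last 2 first.
- by move=> w _; rewrite lee_fin mulr_ge0 // indicE.
- exact/measurable_EFinP.
under [in RHS]eq_integral do rewrite EFinM.
rewrite ge0_integralZl_EFin //; last exact/measurable_EFinP.
by rewrite ZV // integral_indic // setIT muleCA.
Qed.

(** [ZV] is the case of indicators; linearity gives simple functions, and monotone convergence gives
    [g]. *)
Lemma integral_independent_factor (g : E -> R) :
  measurable_fun setT g -> (forall x, (0 <= g x)%R) ->
  \int[P]_w (Z w * g (V w))%:E = C%:E * \int[mu]_x (g x)%:E.
Proof.
move=> mg g0.
have mg' : measurable_fun setT (EFin \o g) by exact/measurable_EFinP.
have g'0 x : setT x -> 0 <= (EFin \o g) x by move=> _; rewrite lee_fin.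
pose f := nnsfun_approx measurableT mg'.
have cvgf x : (f n x)%:E @[n --> \oo] --> (g x)%:E by exact: cvg_nnsfun_approx.
have ndf x m n : (m <= n)%N -> (f m x <= f n x)%R.
  by move=> mn; exact/lefP/nd_nnsfun_approx.
transitivity (limn (fun n => \int[P]_w (Z w * f n (V w))%:E)).
  rewrite -monotone_convergence //.
  - apply: eq_integral => w _; apply/esym/cvg_lim => //.
    under eq_fun do rewrite EFinM.
    by rewrite EFinM; apply: cvgeZl.
  - move=> n; apply/measurable_EFinP; apply: measurable_funM => //.
    exact: measurableT_comp.
  - by move=> n w _; rewrite lee_fin mulr_ge0.
  - by move=> w _ m n mn; rewrite lee_fin ler_wpM2l // ndf.
under eq_fun do rewrite factor_nnsfun.
rewrite limeMl //; last first.
  apply/ereal_nondecreasing_is_cvgn => m n mn; apply: ge0_le_integral => //=.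
  - by move=> ? _; rewrite lee_fin.
  - exact/measurable_EFinP.
  - exact/measurable_EFinP.
  - by move=> x _; rewrite lee_fin ndf.
congr (_ * _); rewrite -monotone_convergence //.
- by apply: eq_integral => x _; apply/cvg_lim.
- by move=> n; exact/measurable_EFinP.
- by move=> n x _; rewrite lee_fin.
- by move=> x _ m n mn; rewrite lee_fin ndf.
Qed.

End independent_factor.

(** * Poisson and uniform moments, and products over blocks of jumps *)

(** This is the exponential series at [mu * r]. With r = 1 / (q + 1), the [q]-th moment of a uniform
    variable, it yields the [q]-th moment of a block factor. *)
Lemma poisson_generating_function (R : realType) (mu r : R) : 0 < mu -> 0 <= r ->
  (\sum_(k <oo) (poisson_pmf mu k * r ^+ k)%:E = (expR (- (mu * (1 - r))))%:E)%E.
Proof.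
move=> mu0 r0.
transitivity (\sum_(k <oo) ((expR (- mu))%:E * (exp_coeff (mu * r) k)%:E))%E.
  apply: eq_eseriesr => k _; rewrite /poisson_pmf mu0 -EFinM; congr _%:E.
  by rewrite /exp_coeff /= exprMn; ring.
have e0 k : 0 <= exp_coeff (mu * r) k.
  by rewrite /exp_coeff /= divr_ge0 // exprn_ge0 // mulr_ge0 // ltW.
rewrite nneseriesZl //; last by move=> k _; rewrite lee_fin.
rewrite mulrBr mulr1 opprB addrC expRD EFinM; congr (_ * _)%E.
rewrite /expR -EFin_lim; last exact: is_cvg_series_exp_coeff.
by apply/congr_lim/funext => n /=; rewrite /series /= sumEFin.
Qed.

(** A Beta integral. The values of [g] are prescribed on [0, 1] only, so that powers of [clamp01]
    qualify. *)
Lemma integral_uniform_exprn (R : realType) (g : R -> R) (q : nat) :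
  measurable_fun setT g -> (forall x, 0 <= g x) ->
  (forall x, 0 <= x <= 1 -> g x = x ^+ q) ->
  (\int[uniform_prob (@ltr01 R)]_x (g x)%:E = (q.+1%:R^-1)%:E)%E.
Proof.
move=> mg g0 gE; rewrite integral_uniform; last 2 first.
- exact/measurable_EFinP.
- by move=> x; rewrite lee_fin.
rewrite subr0 invr1 mul1e.
rewrite -(@beta_fun1Sn R q) beta_fun_sym EFin_beta_fun integral_XMonemX_restrict setTI.
apply: eq_integral => x; rewrite inE /= in_itv /= => x01.
by rewrite gE // /XMonemX expr0 mulr1.
Qed.

(* Makes the U_k bounded everywhere, not only almost surely. *)
Definition clamp01 (R : realType) (x : R) : R := Num.max 0 (Num.min x 1).

Lemma clamp01_bounds (R : realType) (x : R) : 0 <= clamp01 x <= 1.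
Proof. by rewrite /clamp01 le_max lexx /= ge_max ler01 ge_min lexx orbT. Qed.

Lemma clamp01_id (R : realType) (x : R) : 0 <= x <= 1 -> clamp01 x = x.
Proof. by case/andP=> x0 x1; rewrite /clamp01 min_l // max_r. Qed.

Lemma measurable_clamp01 (R : realType) : measurable_fun setT (@clamp01 R).
Proof.
apply: measurable_maxr; first exact: measurable_cst.
by apply: measurable_minr => //; exact: measurable_cst.
Qed.

(** The index range is kept, with 1 in place of the isolated factor, so that factors can be
    exchanged one at a time. *)
Lemma prodrD1_nat (R : comNzRingType) (c j : nat) (F : nat -> R) :
  (1 <= j < c)%N ->
  \prod_(1 <= l < c) F l =
  F j * \prod_(1 <= l < c) (if l == j then 1 else F l).
Proof.
move=> jc; rewrite (bigD1_seq j) ?mem_index_iota ?iota_uniq //=.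
rewrite big_mkcond /=; congr (_ * _); apply: eq_bigr => l _.
by case: eqP.
Qed.

(* With [k i] jumps in block [i], [q l] is the exponent attached to the block
   containing the [l]-th jump. *)
Lemma regroup_blocks (k p : nat -> nat) (m : nat) :
  exists q : nat -> nat, forall (R : comNzRingType) (F : nat -> nat -> R),
    \prod_(i < m) \prod_((\sum_(i' < i) k i').+1 <= l < (\sum_(i' < i.+1) k i').+1)
      F l (p i) =
    \prod_(1 <= l < (\sum_(i < m) k i).+1) F l (q l).
Proof.
elim: m => [|m [q IH]].
  by exists (fun=> 0%N) => R F; rewrite !big_ord0 big_geq.
exists (fun l => if (l <= \sum_(i < m) k i)%N then q l else p m) => R F.
rewrite big_ord_recr /= IH [in RHS](big_cat_nat _ (n := (\sum_(i < m) k i).+1)) //=.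
  congr (_ * _); apply: eq_big_nat => l /andP[l1 l2].
    by rewrite -ltnS l2.
  by rewrite leqNgt l1.
by rewrite ltnS big_ord_recr leq_addr.
Qed.

(** * Moments of the discretized process *)

Section discretization_moments.
Context d (Om : measurableType d) (R : realType) (P : probability Om R).
Variables (m : nat) (mu : R) (K : nat -> Om -> nat) (U : nat -> Om -> R).
Hypotheses (mu_gt0 : 0 < mu) (mK : forall i, measurable_fun setT (K i)).
Hypothesis mU : forall l, measurable_fun setT (U l).

Local Notation unif := (uniform_prob (@ltr01 R)).
Local Notation pmf := (poisson_pmf mu).
Local Notation hit k i w := ((K i w == k i)%:R : R).

(** Encodes in one formula that the block counts are independent Poisson variables, that the [U l]
    are independent uniform ones, and that the two groups are independent. [grid_independence]
    supplies it. *)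
Hypothesis KU : forall (k : nat -> nat) (c : nat) (B : nat -> set R),
  (forall l, measurable (B l)) ->
  (\int[P]_w (\prod_(i < m) hit k i w *
              \prod_(1 <= l < c.+1) \1_(B l) (U l w))%:E =
   (\prod_(i < m) pmf (k i) * \prod_(1 <= l < c.+1) fine (unif (B l)))%:E)%E.

Let measurable_hit (k : nat -> nat) (i : nat) : measurable_fun setT (fun w => hit k i w).
Proof.
apply: (measurableT_comp (f := fun n : nat => (n == k i)%:R : R)) => //.
Qed.

Let measurable_hits (k : nat -> nat) n :
  measurable_fun setT (fun w => \prod_(i < n) hit k i w).
Proof. by apply: measurable_prod => i _; exact: measurable_hit. Qed.

Let integral_product_form (k : nat -> nat) c (psi : nat -> R -> R) (a : nat -> R) :
  (forall l, measurable_fun setT (psi l)) -> (forall l x, 0 <= psi l x) ->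
  (forall l, (\int[unif]_x (psi l x)%:E = (a l)%:E)%E) ->
  (\int[P]_w (\prod_(i < m) hit k i w *
              \prod_(1 <= l < c.+1) psi l (U l w))%:E =
   (\prod_(i < m) pmf (k i) * \prod_(1 <= l < c.+1) a l)%:E)%E.
Proof.
(* The indicators [psi l], l = 1, ..., c, are replaced by general functions one
   at a time. *)
suff gen j : (j <= c)%N -> forall (psi : nat -> R -> R) (a : nat -> R),
    (forall l, measurable_fun setT (psi l)) -> (forall l x, 0 <= psi l x) ->
    (forall l, (\int[unif]_x (psi l x)%:E = (a l)%:E)%E) ->
    (forall l, (j < l <= c)%N -> forall x, psi l x = 0 \/ psi l x = 1) ->
    (\int[P]_w (\prod_(i < m) hit k i w *
                \prod_(1 <= l < c.+1) psi l (U l w))%:E =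
     (\prod_(i < m) pmf (k i) * \prod_(1 <= l < c.+1) a l)%:E)%E.
  move=> mpsi psi0 psia; apply: (gen c) => // l /andP[cl lc].
  by rewrite leqNgt cl in lc.
elim: j => [_|j IHj jc] {}psi {}a mpsi psi0 psia psi01.
  (* No general function is left: for 1 <= l <= c, [psi l] is the indicator of its level set at 1,
     and [KU] applies. *)
  pose B l := psi l @^-1` [set 1].
  have mB l : measurable (B l) by rewrite -[B l]setTI; exact: mpsi.
  have psiE l : (1 <= l < c.+1)%N -> psi l = \1_(B l).
    rewrite ltnS => lc; apply/funext => x; rewrite indicE.
    case: (psi01 l lc x) => psix; last by rewrite mem_set.
    rewrite memNset //; rewrite /B /= psix => /esym/eqP.
    by rewrite oner_eq0.
  have -> : \prod_(1 <= l < c.+1) a l = \prod_(1 <= l < c.+1) fine (unif (B l)).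
    apply: eq_big_nat => l lc; have := psia l; rewrite psiE //.
    by rewrite integral_indic //; [rewrite setIT => -> | exact: mB].
  rewrite -(KU k c mB); apply: eq_integral => w _; congr (_ * _)%:E.
  by apply: eq_big_nat => l lc; rewrite psiE.
have jc' : (1 <= j.+1 < c.+1)%N by [].
pose Z w := \prod_(i < m) hit k i w *
  \prod_(1 <= l < c.+1) (if l == j.+1 then 1 else psi l (U l w)).
pose C := \prod_(i < m) pmf (k i) *
  \prod_(1 <= l < c.+1) (if l == j.+1 then 1 else a l).
have a0 l : 0 <= a l.
  by rewrite -lee_fin -psia; apply: integral_ge0 => x _; rewrite lee_fin.
transitivity (\int[P]_w (Z w * psi j.+1 (U j.+1 w))%:E)%E.
  by apply: eq_integral => w _; rewrite (prodrD1_nat _ jc') /Z mulrCA mulrC.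
rewrite (prodrD1_nat _ jc') mulrCA mulrC EFinM -psia.
apply: (integral_independent_factor (C := C)) => //.
- apply: measurable_funM => //; apply: measurable_prod => l _.
  by case: eqP => // _; exact: (measurableT_comp (mpsi l) (mU l)).
- move=> w; rewrite /Z /=; apply: mulr_ge0; apply: prodr_ge0 => l _ //.
  by case: eqP.
- exact: mU.
(* With an indicator at index j + 1, only the functions up to index [j] may be general, so the
   induction hypothesis applies. *)
- move=> B mB.
  transitivity (\int[P]_w (\prod_(i < m) hit k i w *
    \prod_(1 <= l < c.+1) (if l == j.+1 then \1_B : R -> R else psi l) (U l w))%:E)%E.
    apply: eq_integral => w _; rewrite [in RHS](prodrD1_nat _ jc') eqxx /Z.
    rewrite mulrCA mulrC; congr (_ * (_ * _))%:E.
    by apply: eq_bigr => l _; case: eqP.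
  rewrite (IHj (ltnW jc) (fun l => if l == j.+1 then \1_B : R -> R else psi l)
    (fun l => if l == j.+1 then fine (unif B) else a l)).
  + rewrite (prodrD1_nat _ jc') eqxx mulrCA mulrC EFinM fineK ?fin_num_measure //.
    by congr ((_ * _)%:E * _)%E; apply: eq_bigr => l _; case: eqP.
  + by move=> l; case: eqP => // _; exact: measurable_indic.
  + by move=> l x; case: eqP => // _; rewrite indicE.
  + move=> l; case: eqP => // _.
    by rewrite integral_indic // setIT fineK // fin_num_measure.
  + move=> l /andP[jl lc] x; case: eqP => [_|/eqP lj].
      by rewrite indicE; case: (_ \in _); [right|left].
    by apply: psi01; rewrite lc ltn_neqAle eq_sym lj jl.
- exact: mpsi.
Qed.

Definition total_count (w : Om) (i : nat) : nat := (\sum_(i' < i) K i' w)%N.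

Definition clamped (w : Om) (l : nat) : R := clamp01 (U l w).

Local Notation V i w := (collapse (total_count w) (clamped w) i).

Let clamped_bounds w l : 0 <= clamped w l <= 1.
Proof. exact: clamp01_bounds. Qed.

Let V_bounds i w : 0 <= V i w <= 1.
Proof. exact: prod_bounds. Qed.

Lemma measurable_total_count i : measurable_fun setT (total_count ^~ i).
Proof.
elim: i => [|i IHi].
  rewrite (_ : total_count ^~ 0%N = cst 0%N) //.
  by apply/funext => w; rewrite /total_count big_ord0.
rewrite (_ : total_count ^~ i.+1 = fun w => (total_count w i + K i w)%N).
  apply: (measurable_nat_index (M := K i) (g := fun b w => (total_count w i + b)%N)) => // b.
  exact: (measurableT_comp (f := addn^~ b)).
by apply/funext => w; rewrite /total_count big_ord_recr.
Qed.

Lemma measurable_collapse i : measurable_fun setT (fun w => V i w).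
Proof.
rewrite /collapse.
apply: (measurable_nat_index (M := total_count ^~ i.+1)
  (g := fun b w => \prod_((total_count w i).+1 <= l < b.+1) clamped w l)).
  exact: measurable_total_count.
move=> b; apply: (measurable_nat_index (M := total_count ^~ i)
  (g := fun a w => \prod_(a.+1 <= l < b.+1) clamped w l)).
  exact: measurable_total_count.
move=> a; apply: measurable_prod => l _.
exact: (measurableT_comp (@measurable_clamp01 R)).
Qed.

Lemma measurable_discrete_growth h i :
  measurable_fun setT (fun w => discrete_growth h (total_count w) (clamped w) i).
Proof.
elim: i => [|i IHi] /=; first exact: measurable_cst.
apply: measurable_funD; first exact: measurable_cst.
by apply: measurable_funM => //; exact: measurable_collapse.
Qed.

Lemma discrete_growth_bounds h i w : 0 <= h ->
  0 <= discrete_growth h (total_count w) (clamped w) i <= i%:R * h.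
Proof.
move=> h0; elim: i => [|i /andP[lo hi]] /=; first by rewrite mul0r lexx.
have /andP[V0 V1] := V_bounds i w; rewrite -natr1 mulrDl mul1r.
apply/andP; split; first by rewrite addr_ge0 // mulr_ge0.
rewrite addrC lerD2r (le_trans _ hi) //.
by rewrite ler_piMl.
Qed.

(** The [q]-th moment of a block factor, a product of a Poisson number of independent uniform
    variables. *)
Let laplace q : R := expR (- (mu * (1 - q.+1%:R^-1))).

(** Once all counts are fixed, each jump belongs to a deterministic block, and [regroup_blocks]
    turns the product over blocks into one over finitely many [U l]. *)
Let integral_atom (k p : nat -> nat) :
  (\int[P]_w (\prod_(i < m) hit k i w * \prod_(i < m) V i w ^+ p i)%:E =
   (\prod_(i < m) (pmf (k i) * (p i).+1%:R^-1 ^+ k i))%:E)%E.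
Proof.
have [q qE] := regroup_blocks k p m.
rewrite big_split /=.
have -> : \prod_(i < m) ((p i).+1%:R^-1 : R) ^+ k i =
    \prod_(1 <= l < (\sum_(i < m) k i).+1) (q l).+1%:R^-1.
  rewrite -(qE R (fun _ p => p.+1%:R^-1)); apply: eq_bigr => i _.
  by rewrite prodr_const_nat subSS big_ord_recr /= addKn.
rewrite -(@integral_product_form k _ (fun l x => clamp01 x ^+ q l)).
- apply: eq_integral => w _; congr _%:E.
  (* Off the atom some factor [hit] is zero and both integrands vanish. *)
  have [/forallP hits|] := boolP [forall i : 'I_m, K i w == k i]; last first.
    rewrite negb_forall => /existsP[i /negbTE Ki].
    by rewrite (bigD1 i) //= Ki !mul0r.
  congr (_ * _); rewrite -(qE R (fun l p => clamped w l ^+ p)).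
  have cE i : (i <= m)%N -> total_count w i = (\sum_(i' < i) k i')%N.
    move=> im; apply: eq_bigr => i' _.
    by apply/eqP; exact: (hits (widen_ord im i')).
  apply: eq_bigr => i _; rewrite /collapse -prodrXl.
  by rewrite !cE // ltnW.
- by move=> l; apply: measurable_funX; exact: measurable_clamp01.
- by move=> l x; rewrite exprn_ge0 //; case/andP: (clamp01_bounds x).
- move=> l; apply: integral_uniform_exprn.
  + by apply: measurable_funX; exact: measurable_clamp01.
  + by move=> x; rewrite exprn_ge0 //; case/andP: (clamp01_bounds x).
  + by move=> x x01; rewrite clamp01_id.
Qed.

Let V_prod_ge0 (p : nat -> nat) w : 0 <= \prod_(i < m) V i w ^+ p i.
Proof.
by apply: prodr_ge0 => i _; rewrite exprn_ge0 //; case/andP: (V_bounds i w).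
Qed.

Let measurable_V_prod (p : nat -> nat) :
  measurable_fun setT (fun w => \prod_(i < m) V i w ^+ p i).
Proof.
by apply: measurable_prod => i _; apply: measurable_funX; exact: measurable_collapse.
Qed.

(* Summing over the values of the [m - n]-th increment releases the constraint
   on it, going from the joint atom of all increments to no constraint. *)
Let integral_partial_atom (p : nat -> nat) n : (n <= m)%N -> forall k : nat -> nat,
  (\int[P]_w (\prod_(i < m - n) hit k i w * \prod_(i < m) V i w ^+ p i)%:E =
   (\prod_(i < m - n) (pmf (k i) * (p i).+1%:R^-1 ^+ k i) *
    \prod_(m - n <= i < m) laplace (p i))%:E)%E.
Proof.
elim: n => [_|n IHn nm] k.
  by rewrite subn0 integral_atom [X in _ * X]big_geq // mulr1.
set i := (m - n.+1)%N; have iE : (m - n = i.+1)%N by rewrite /i subnSK.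
have im : (i < m)%N by rewrite /i ltn_subrL /= (leq_trans _ nm).
pose k' x := fun j => if j == i then x else k j.
have k'E x (F : nat -> nat -> R) : \prod_(j < i.+1) F j (k' x j) =
    \prod_(j < i) F j (k j) * F i x.
  rewrite big_ord_recr /= /k' eqxx; congr (_ * _); apply: eq_bigr => j _.
  by rewrite ltn_eqF.
(* Inserts the partition of unity formed by the events K_i = x; exactly one term is not killed by
   its indicator. *)
transitivity (\int[P]_w (\sum_(x <oo)
    (\prod_(j < i.+1) hit (k' x) j w * \prod_(i < m) V i w ^+ p i)%:E))%E.
  apply: eq_integral => w _.
  rewrite (nneseriesD1 (n := K i w)) //; last first.
    by move=> x _; rewrite lee_fin mulr_ge0 // prodr_ge0.
  rewrite (k'E _ (fun j x => (K j w == x)%:R)) eqxx mulr1.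
  rewrite eseries0 ?adde0 // => x _ xK.
  by rewrite (k'E _ (fun j x => (K j w == x)%:R)) eq_sym (negbTE xK) mulr0 mul0r.
rewrite integral_nneseries //; last 2 first.
- by move=> x; apply/measurable_EFinP; apply: measurable_funM.
- by move=> x w _; rewrite lee_fin mulr_ge0 // prodr_ge0.
rewrite [in RHS]big_ltn // -/i.
transitivity (\sum_(x <oo) ((\prod_(j < i) (pmf (k j) * (p j).+1%:R^-1 ^+ k j) *
   \prod_(i.+1 <= i < m) laplace (p i))%:E * (pmf x * (p i).+1%:R^-1 ^+ x)%:E))%E.
  apply: eq_eseriesr => x _; rewrite -iE IHn ?(ltnW nm) // iE.
  rewrite (k'E _ (fun j x => pmf x * (p j).+1%:R^-1 ^+ x)) -EFinM.
  by congr _%:E; ring.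
rewrite nneseriesZl; last first.
  by move=> x _; rewrite lee_fin mulr_ge0 ?poisson_pmf_ge0 // exprn_ge0.
rewrite poisson_generating_function // -EFinM; congr _%:E; rewrite /laplace; ring.
Qed.

Lemma integral_collapse_prod (p : nat -> nat) :
  (\int[P]_w (\prod_(i < m) V i w ^+ p i)%:E =
   (\prod_(i < m) laplace (p i))%:E)%E.
Proof.
(* With [n = m] no constraint remains, so the values prescribed by [k] are immaterial. *)
have := integral_partial_atom p (leqnn m) (fun=> 0%N).
rewrite subnn !big_ord0 big_mkord mul1r => <-.
by apply: eq_integral => w _; rewrite big_ord0 mul1r.
Qed.

(* The factors [V_j] with [j >= i] are carried along because expanding
   [Y_(i+1) ^ n] produces [Y_i ^ j * V_i ^ j]. *)
Lemma integral_discrete_growth_mixed (lambda h : R) : 0 <= h -> mu = lambda * h ->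
  forall i n (p : nat -> nat), (i <= m)%N ->
  (\int[P]_w (discrete_growth h (total_count w) (clamped w) i ^+ n *
              \prod_(i <= j < m) V j w ^+ p j)%:E =
   (moment_scheme lambda h i n * \prod_(i <= j < m) laplace (p j))%:E)%E.
Proof.
move=> h0 muE; elim=> [|i IHi] n p im.
  rewrite /= expr0n; case: n => [|n] /=.
    rewrite mul1r big_mkord -integral_collapse_prod.
    by apply: eq_integral => w _; rewrite big_mkord mul1r.
  by under eq_integral do rewrite mul0r; rewrite integral0 mul0r.
(* Gives V_i the exponent [j] coming from the binomial expansion of (h + V_i Y_i)^n. *)
pose p' j := fun l => if l == i then j else p l.
have p'E j (F : nat -> nat -> R) : \prod_(i <= l < m) F l (p' j l) =
    F i j * \prod_(i.+1 <= l < m) F l (p l).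
  rewrite big_ltn // /p' eqxx; congr (_ * _); apply: eq_big_nat => l /andP[il _].
  by rewrite gtn_eqF.
pose Y i w := discrete_growth h (total_count w) (clamped w) i.
have Y0 i' w : 0 <= Y i' w by case/andP: (discrete_growth_bounds i' w h0).
transitivity (\int[P]_w (\sum_(j < n.+1) (('C(n, j)%:R * h ^+ (n - j))%:E *
    (Y i w ^+ j * \prod_(i <= l < m) V l w ^+ p' j l)%:E)))%E.
  apply: eq_integral => w _; rewrite -/(Y i.+1 w) [Y i.+1 w]/= exprDn mulr_suml.
  rewrite sumEFin; congr _%:E; apply: eq_bigr => j _.
  rewrite (p'E _ (fun l x => V l w ^+ x)) exprMn -mulr_natl /Y; ring.
have mprod j : measurable_fun setT (fun w => \prod_(i <= l < m) V l w ^+ p' j l).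
  by apply: measurable_prod => l _; apply: measurable_funX; exact: measurable_collapse.
have mY j : measurable_fun setT (fun w => (Y i w ^+ j * \prod_(i <= l < m) V l w ^+ p' j l)).
  apply: measurable_funM => //; apply: measurable_funX; exact: measurable_discrete_growth.
have Yp0 j w : 0 <= Y i w ^+ j * \prod_(i <= l < m) V l w ^+ p' j l.
  rewrite mulr_ge0 ?exprn_ge0 // prodr_ge0 // => l _; rewrite exprn_ge0 //.
  by case/andP: (V_bounds l w).
have C0 j : 0 <= 'C(n, j)%:R * h ^+ (n - j) by rewrite mulr_ge0 ?exprn_ge0.
rewrite ge0_integral_sum //; last 2 first.
- by move=> j; apply: measurable_funeM; exact/measurable_EFinP.
- by move=> j w _; rewrite mule_ge0 ?lee_fin.
rewrite [moment_scheme _ _ _ _]/= mulr_suml -sumEFin; apply: eq_bigr => j _.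
rewrite ge0_integralZl_EFin //; last 2 first.
- by move=> w _; rewrite lee_fin.
- exact/measurable_EFinP.
rewrite IHi ?(ltnW im) // (p'E _ (fun _ x => laplace x)) -EFinM; congr _%:E.
have -> : laplace j = expR (- (decay lambda j * h)).
  rewrite /laplace /decay muE; congr (expR (- _)).
  have -> : 1 - j.+1%:R^-1 = j%:R / j.+1%:R :> R.
    have n0 : j.+1%:R != 0 :> R by rewrite pnatr_eq0.
    by apply: (canRL (mulfK n0)); rewrite mulrBl mul1r mulVf // -natr1 addrK.
  ring.
ring.
Qed.

End discretization_moments.

(** * Independence, counting paths and limits *)

(** Equipping [Om] with the generated sigma-algebra lets membership in [sigma_family] follow from
    the usual closure rules of measurability. *)
Lemma sigma_family_measurable (Om : pointedType) d (E : measurableType d) (I : Type)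
    (D : set I) (X : I -> Om -> E) (i : I) : D i ->
  measurable_fun [set: g_sigma_algebraType
    (\bigcup_(i in D) preimage_set_system setT (X i) measurable)] (X i).
Proof.
by move=> Di _ B mB; apply: sub_sigma_algebra; exists i => //; exists B.
Qed.

Lemma mutually_independent_seq d (Om : measurableType d) (R : realType)
    (P : probability Om R) d' (E : measurableType d') (D : set nat)
    (X : nat -> Om -> E) (A : nat -> set E) (s : seq nat) :
  mutually_independent P D X -> uniq s -> (forall i, i \in s -> D i) ->
  (forall i, measurable (A i)) ->
  (P (\bigcap_(i in [set` s]) (X i @^-1` A i)) =
   \prod_(i <- s) P (X i @^-1` A i))%E.
Proof.
move=> indep us sD mA.
pose J := [fset i in s]%fset.
have JE i : (i \in J) = (i \in s) by rewrite !inE.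
have -> : [set` s] = [set` J] by apply/seteqP; split => i /=; rewrite JE.
rewrite indep //; last by move=> i /=; rewrite JE; exact: sD.
by apply: perm_big; apply: uniq_perm => // i; rewrite JE.
Qed.

(** If T_k <= t, the first k indicators equal 1 and N t >= k. Otherwise all indicators from index k
    on vanish and N t <= k - 1. *)
Lemma counting_leqE (R : realType) (N : R -> nat) (T : nat -> R) :
  (forall k, (1 <= k)%N -> T k < T k.+1) ->
  (forall t : R, 0 <= t ->
     (((N t)%:R : R)%:E = \sum_(1 <= k <oo) (\1_(`[T k, +oo[) t)%:E)%E) ->
  forall (t : R) k, 0 <= t -> (1 <= k)%N -> (k <= N t)%N = (T k <= t).
Proof.
move=> Tinc NE t k t0 k1.
have Tmono i j : (1 <= i)%N -> (i <= j)%N -> T i <= T j.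
  move=> i1; elim: j => [|j IHj]; first by rewrite leqn0 => /eqP->.
  rewrite leq_eqVlt => /predU1P[->//|]; rewrite ltnS => ij.
  by apply: le_trans (IHj ij) _; rewrite ltW // Tinc // (leq_trans i1).
have ind j : (\1_(`[T j, +oo[ : set R) t : R) = (T j <= t)%R%:R.
  by rewrite indicE mem_setE in_itv /= andbT.
have NtE := NE t t0.
have ge0 j : (0 <= (\1_(`[T j, +oo[ : set R) t : R)%:E)%E by rewrite lee_fin indicE.
have [Tkt|tTk] := leP (T k) t.
  have : (\sum_(1 <= j < k.+1) (\1_(`[T j, +oo[ : set R) t : R)%:E <= ((N t)%:R : R)%:E)%E.
    by rewrite NtE; apply: nneseries_lim_ge.
  rewrite sumEFin lee_fin (eq_big_nat _ _ (F2 := fun=> 1)); last first.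
    move=> j /andP[j1 jk]; rewrite ind (le_trans _ Tkt) //.
    by apply: Tmono.
  by rewrite big_const_nat iter_addr_0 subSS subn0 ler_nat.
have : (((N t)%:R : R)%:E <= ((k.-1)%:R : R)%:E)%E.
  rewrite NtE (nneseries_split _ k.-1) // add1n prednK //.
  rewrite eseries0 ?adde0; last first.
    move=> j kj _; rewrite ind leNgt (lt_le_trans tTk) //.
    exact: Tmono.
  rewrite sumEFin lee_fin.
  apply: (@le_trans _ _ (\sum_(1 <= j < k) 1)).
    by apply: ler_sum => j _; rewrite ind lern1 leq_b1.
  by rewrite big_const_nat iter_addr_0 subn1.
rewrite lee_fin ler_nat => Nk; apply/negbTE; rewrite -ltnNge.
by rewrite -(prednK k1) ltnS.
Qed.

(** In the factorization of x^n - y^n by x - y, the cofactor has n terms, each at most t^(n - 1) in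
    absolute value. *)
Lemma norm_exprnB_le (R : realType) (x y t h : R) (n : nat) :
  `|x| <= t -> `|y| <= t -> `|x - y| <= h ->
  `|x ^+ n - y ^+ n| <= h * (n%:R * t ^+ n.-1).
Proof.
move=> xt yt xyh; rewrite subrXX normrM ler_pM //.
apply: le_trans (ler_norm_sum _ _ _) _.
have t0 : 0 <= t := le_trans (normr_ge0 _) xt.
rewrite mulr_natl -[X in _ *+ X]card_ord -sumr_const; apply: ler_sum => i _.
rewrite normrM !normrX.
have -> : t ^+ n.-1 = t ^+ (n.-1 - i) * t ^+ i.
  by rewrite -exprD subnK // -ltnS (ltn_predK (ltn_ord i)).
by rewrite -subn1 -subnDA add1n ler_pM ?exprn_ge0 // lerXn2r ?nnegrE.
Qed.

(** The term k = 0 is constantly 1; every other one decays at the positive rate k lambda / (k +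
    1). *)
Lemma moment_cvgy (R : realType) (lambda : R) (n : nat) : 0 < lambda ->
  moment lambda n t @[t --> +oo] --> (n.+1)`!%:R / lambda ^+ n.
Proof.
move=> l0; rewrite /moment.
have lim1 : \sum_(0 <= k < n.+1) (k == 0%N)%:R = 1 :> R.
  by rewrite big_ltn // big_nat_cond big1 ?addr0 // => -[|k] // /andP[].
rewrite -[X in _ --> X]mulr1; apply: cvgMr; rewrite -[X in _ --> X]lim1.
apply: cvg_big => //; first exact: add_continuous.
case=> [|k] _.
  rewrite (_ : (fun t => _) = cst 1); first exact: cvg_cst.
  by apply/funext => t /=; rewrite expr0 exp1rz bin0 !mul0r oppr0 expR0 !mulr1.
rewrite -[X in _ --> X](mulr0 ((-1) ^+ k.+1 * (k.+2%:R : R) ^ (n%:Z - 1) * 'C(n, k.+1)%:R)).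
apply: cvgMr; apply: (cvg_comp _ (fun x => expR (- x)) _ (@cvgr_expR R)).
have a0 : 0 < k.+1%:R * lambda / k.+2%:R by rewrite divr_gt0 // mulr_gt0.
under eq_fun do rewrite mulrAC.
by have := gt0_cvgMry (f := id) a0 (@cvg_id _ (pinfty_nbhs R)); apply.
Qed.

Lemma measurable_fun_subn d (Om : measurableType d)
    (A B : Om -> nat) : measurable_fun setT A -> measurable_fun setT B ->
  measurable_fun setT (fun w => (A w - B w)%N).
Proof.
move=> mA mB.
apply: (measurable_nat_index (M := B) (g := fun b w => (A w - b)%N)) => // b.
exact: (measurableT_comp (f := subn^~ b)).
Qed.

Lemma indic_bigcap_seq (R : realType) (T : Type) (I : eqType) (s : seq I)
    (A : I -> set T) (w : T) :
  \1_(\bigcap_(i in [set` s]) A i) w = \prod_(i <- s) \1_(A i) w :> R.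
Proof.
elim: s => [|i s IHs].
  by rewrite big_nil indicE mem_set // => i; rewrite /= in_nil.
rewrite big_cons -IHs !indicE.
have -> : \bigcap_(j in [set` i :: s]) A j = A i `&` \bigcap_(j in [set` s]) A j.
  apply/seteqP; split=> [x Ax|x [Aix Ax] j /=].
    by split=> [|j js]; apply: Ax; rewrite /= in_cons ?eqxx // js orbT.
  by rewrite in_cons => /predU1P[->//|js]; exact: Ax.
by rewrite in_setI -natrM mulnb.
Qed.

(** * Moments of the growth-collapse process *)

Section growth_collapse_moments.
Context (R : realType) (d : measure_display) (Omega : measurableType d).
Context (P : probability Omega R) (lambda : R).
Context (N : R -> {RV P >-> nat}) (T U : nat -> {RV P >-> R}).
Hypotheses (lambda_gt0 : 0 < lambda) (N_poisson : poisson_process lambda N T).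
Hypothesis U_iid : iid_uniform01 U.
Hypothesis NU_indep : independent_families P
  [set t : R | 0 <= t] (fun t => N t : Omega -> nat)
  [set k : nat | (1 <= k)%N] (fun k => U k : Omega -> R).

Local Notation K h := (fun i : nat => increment N (i%:R * h) (i.+1%:R * h)).
Local Notation unif := (uniform_prob (@ltr01 R)).

(** The integrand is the indicator of [EN] intersected with [EU]. [NU_indep] separates the two
    events; independent increments and the independence of the [U l] then factor each
    probability. *)
Lemma grid_independence (h : R) (m : nat) : 0 < h ->
  forall (k : nat -> nat) (c : nat) (B : nat -> set R),
  (forall l, measurable (B l)) ->
  (\int[P]_w (\prod_(i < m) ((K h i w == k i)%:R : R) *
              \prod_(1 <= l < c.+1) \1_(B l) (U l w))%:E =
   (\prod_(i < m) poisson_pmf (lambda * h) (k i) *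
    \prod_(1 <= l < c.+1) fine (unif (B l)))%:E)%E.
Proof.
move=> h0 k c B mB.
have [_ indepN poisN] := N_poisson; have [indepU unifU] := U_iid.
pose sN := iota 0 m; pose sU := index_iota 1 c.+1.
pose EN := \bigcap_(i in [set` sN]) (K h i @^-1` [set k i]).
pose EU := \bigcap_(l in [set` sU]) (U l @^-1` B l).
have sEN : sigma_family [set t : R | 0 <= t] (fun t => N t : Omega -> nat) EN.
  rewrite /sigma_family.
  apply: (@fin_bigcap_measurable _ (g_sigma_algebraType _)) => // i _.
  rewrite -[X in measurable X]setTI.
  apply: (@measurable_fun_subn _ (g_sigma_algebraType _)) => //.
  - by apply: (@sigma_family_measurable _ _ _ _ _ (fun t => N t : Omega -> nat));
      rewrite /= mulr_ge0 // ltW.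
  - by apply: (@sigma_family_measurable _ _ _ _ _ (fun t => N t : Omega -> nat));
      rewrite /= mulr_ge0 // ltW.
have sEU : sigma_family [set k : nat | (1 <= k)%N] (fun k => U k : Omega -> R) EU.
  rewrite /sigma_family.
  apply: (@fin_bigcap_measurable _ (g_sigma_algebraType _)) => // l.
  rewrite /= mem_index_iota => /andP[l1 _].
  rewrite -[X in measurable X]setTI.
  exact: (@sigma_family_measurable _ _ _ _ _ (fun k => U k : Omega -> R)).
have mK i : measurable_fun setT (K h i) by exact: measurable_fun_subn.
have mEN : measurable EN.
  apply: fin_bigcap_measurable => // i _.
  by rewrite -[X in measurable X]setTI; exact: mK.
have mEU : measurable EU.
  apply: fin_bigcap_measurable => // l _.
  by rewrite -[X in measurable X]setTI; exact: measurable_funP.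
have PN : P EN = (\prod_(i < m) poisson_pmf (lambda * h) (k i))%:E.
  rewrite /EN (mutually_independent_seq (D := [set i | (i < m)%N])) //.
  - rewrite -(big_mkord xpredT (fun i => poisson_pmf (lambda * h) (k i))).
    rewrite /index_iota subn0 -prodEFin.
    apply: eq_bigr => i _.
    rewrite (poisN (i%:R * h) (i.+1%:R * h)) ?mulr_ge0 ?(ltW h0) //.
      by rewrite -mulrBl -natrB // subSnn mul1r.
    by rewrite ltr_pM2r // ltr_nat.
  - apply: (indepN m (fun i => i%:R * h)); first by rewrite mul0r.
    by move=> i _; rewrite ltr_pM2r // ltr_nat.
  - exact: iota_uniq.
  - by move=> i; rewrite mem_iota /= add0n.
have PU : P EU = (\prod_(1 <= l < c.+1) fine (unif (B l)))%:E.
  rewrite /EU (mutually_independent_seq indepU) ?iota_uniq //; last first.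
    by move=> l; rewrite mem_index_iota => /andP[].
  rewrite -prodEFin; apply: eq_big_nat => l /andP[l1 _].
  have := unifU l l1 (B l) (mB l); rewrite /distribution /pushforward => ->.
  by rewrite fineK // fin_num_measure //; exact: mB.
rewrite EFinM -PN -PU -NU_indep // -[EN `&` EU]setIT -integral_indic //; last first.
  exact: measurableI.
apply: eq_integral => w _; congr _%:E.
rewrite indicI /= /EN /EU !indic_bigcap_seq; congr (_ * _).
rewrite -(big_mkord xpredT (fun i => (K h i w == k i)%:R)) /index_iota subn0.
apply: eq_bigr => i _; rewrite indicE; congr (nat_of_bool _)%:R.
by apply/eqP/idP => [Kw|/set_mem//]; rewrite mem_set.
Qed.

Lemma counting_ae : {ae P, forall w, 0 < T 1%N w /\
  forall (t : R) k, 0 <= t -> (1 <= k)%N -> (k <= N t w)%N = (T k w <= t)}.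
Proof.
have [cnt _ _] := N_poisson; apply: filterS cnt => w [T1 Tinc NE].
by split=> // t k; exact: (counting_leqE (N := N^~ w) (T := T^~ w)).
Qed.

Lemma uniform_ae : {ae P, forall w, forall k, (1 <= k)%N -> 0 <= U k w <= 1}.
Proof.
apply: ae_foralln => k; case: (posnP k) => [->|k1]; first exact: aeW.
pose I := `[0, 1]%classic : set R.
have mI : measurable I by exact: measurable_itv.
exists (U k @^-1` (~` I)); split.
- by rewrite -[X in measurable X]setTI; apply: measurable_funP => //; exact: measurableC.
- have [_ unifU] := U_iid; apply: etrans (unifU k k1 _ (measurableC mI)) _.
  rewrite probability_setC // [X in (_ - X)%E](_ : _ = 1%E) ?subee //.
  exact: integral_uniform_pdf1.
- move=> w /= nU UI; apply: nU => _; move: UI.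
  by rewrite /I /= in_itv.
Qed.

(** Off a null set clamping leaves the [U l] with l >= 1 unchanged, and the pathwise comparison
    applies. *)
Lemma growth_collapse_approx_ae (h : R) (m : nat) : 0 < h ->
  {ae P, forall w,
    discrete_growth h (total_count (K h) w) (clamped U w) m - h
    <= growth_collapse N T U (m%:R * h) w
    <= discrete_growth h (total_count (K h) w) (clamped U w) m}.
Proof.
move=> h0; apply: filterS2 counting_ae uniform_ae => w [T1 cnt] U01.
have clE l : (1 <= l)%N -> clamped U w l = U l w.
  by move=> l1; rewrite /clamped clamp01_id // U01.
have -> : growth_collapse N T U (m%:R * h) w =
    m%:R * h - \sum_(1 <= k < (N (m%:R * h) w).+1)
      T k w * (1 - clamped U w k) *
      \prod_(k.+1 <= l < (N (m%:R * h) w).+1) clamped U w l.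
  congr (_ - _); apply: eq_big_nat => k /andP[k1 _]; rewrite clE //.
  congr (_ * _); apply: eq_big_nat => l /andP[kl _]; rewrite clE //.
  exact: leq_trans kl.
(* The truncated increments add up to N on the grid because N is nondecreasing and vanishes at 0. *)
have -> : total_count (K h) w = fun i => N (i%:R * h) w.
  apply/funext; elim=> [|i IHi].
    rewrite /total_count big_ord0 mul0r.
    by rewrite (counting_at0 (N := N^~ w) (T := T^~ w)).
  rewrite /total_count big_ord_recr /= -/(total_count (K h) w i) IHi /increment.
  rewrite subnKC // (counting_mono (N := N^~ w) (T := T^~ w)) //.
    by rewrite mulr_ge0 // ltW.
  by rewrite ler_pM2r // ler_nat.
apply: (discrete_growth_approx (N := N^~ w) (T := T^~ w)) => //; last exact: ltW.
by move=> l; exact: clamp01_bounds.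
Qed.

Lemma measurable_growth_collapse t : measurable_fun setT (growth_collapse N T U t).
Proof.
rewrite /growth_collapse.
apply: measurable_funB; first exact: measurable_cst.
apply: (measurable_nat_index (M := N t) (g := fun b w => \sum_(1 <= k < b.+1)
  T k w * (1 - U k w) * \prod_(k.+1 <= l < b.+1) U l w)) => // b.
apply: measurable_sum => k; apply: measurable_funM.
  by apply: measurable_funM => //; apply: measurable_funB => //; exact: measurable_cst.
by apply: measurable_prod => l _.
Qed.

(** X^n - Y^n is almost surely at most [c] in absolute value, so X^n has a finite integral within
    [c] of that of Y^n. The real witness [r] records this finiteness. *)
Lemma moment_approx (t : R) (n m : nat) : 0 < t -> (0 < m)%N ->
  exists2 r : R, (\int[P]_w (growth_collapse N T U t w ^+ n)%:E = r%:E)%E &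
    `|r - moment_scheme lambda (t / m%:R) m n| <= n%:R * t ^+ n.-1 * t / m%:R.
Proof.
move=> t0 m0; have mR : 0 < m%:R :> R by rewrite ltr0n.
set h := t / m%:R; have h0 : 0 < h by rewrite divr_gt0.
have tE : m%:R * h = t by rewrite /h mulrC divfK // gt_eqF.
have ht : h <= t by rewrite ler_piMr ?(ltW t0) // invf_le1 // ler1n.
pose X w := growth_collapse N T U t w.
pose Y w := discrete_growth h (total_count (K h) w) (clamped U w) m.
have mK i : measurable_fun setT (K h i) by exact: measurable_fun_subn.
have mX : measurable_fun setT (fun w => X w ^+ n).
  by apply: measurable_funX; exact: measurable_growth_collapse.
have mY : measurable_fun setT (fun w => Y w ^+ n).
  by apply: measurable_funX; exact: measurable_discrete_growth.
have Yt w : 0 <= Y w <= t by rewrite -tE discrete_growth_bounds // ltW.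
have intY : (\int[P]_w (Y w ^+ n)%:E = (moment_scheme lambda h m n)%:E)%E.
  have := integral_discrete_growth_mixed (mulr_gt0 lambda_gt0 h0) mK
    (fun l => measurable_funP (U l)) (@grid_independence h m h0) (ltW h0) (erefl _) n
    (fun=> 0%N) (leqnn m).
  rewrite [X in (_ * X)%:E]big_geq // mulr1 => <-.
  by apply: eq_integral => w _; rewrite [X in _ * X]big_geq // mulr1.
pose c := h * (n%:R * t ^+ n.-1).
have c0 : 0 <= c.
  by apply: mulr_ge0; [exact: ltW | rewrite mulr_ge0 // exprn_ge0 // ltW].
pose D w := X w ^+ n - Y w ^+ n.
have mD : measurable_fun setT D by exact: measurable_funB.
have Dc : (\int[P]_w `|(D w)%:E| <= c%:E)%E.
  rewrite -[leRHS]mule1 -(probability_setT P); apply: integral_le_bound => //.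
    exact/measurable_EFinP.
  apply: filterS (growth_collapse_approx_ae m h0) => w.
  rewrite tE -/(X w) -/(Y w) => /andP[lo hi] _ /=; rewrite lee_fin.
  have /andP[Y0 Y1] := Yt w.
  (* Since 0 <= Y <= t and h <= t, the bounds Y - h <= X <= Y give |X| <= t. *)
  by apply: norm_exprnB_le; rewrite ler_norml; apply/andP; split; lra.
have iD : P.-integrable setT (EFin \o D).
  apply/integrableP; split; first exact/measurable_EFinP.
  by apply: le_lt_trans Dc _; rewrite ltry.
have iY : P.-integrable setT (EFin \o (fun w => Y w ^+ n)).
  apply/integrableP; split; first exact/measurable_EFinP.
  rewrite (eq_integral (fun w => (Y w ^+ n)%:E)) ?intY ?ltry // => w _ /=.
  by rewrite ger0_norm // exprn_ge0 //; case/andP: (Yt w).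
have finD : (\int[P]_w (D w)%:E)%E \is a fin_num by exact: integrable_fin_num.
exists (moment_scheme lambda h m n + fine (\int[P]_w (D w)%:E)%E).
  rewrite EFinD fineK // -intY -integralD_EFin //.
  by apply: eq_integral => w _ /=; rewrite -EFinD /D /X addrC subrK.
rewrite addrAC subrr add0r.
have -> : n%:R * t ^+ n.-1 * t / m%:R = c by rewrite /c /h; ring.
rewrite -lee_fin -abse_EFin fineK //; apply: le_trans Dc.
by apply: le_abse_integral => //; exact/measurable_EFinP.
Qed.

(** For t > 0, [moment_approx] and [moment_scheme_cvg] put the integral within B / m of the formula
    for every m > 0, which forces equality. The case t = 0 is separate because the grid step must be
    positive; there X = 0 almost surely. *)
Lemma growth_collapse_moment (n : nat) (t : R) : 0 <= t ->
  (\int[P]_w (growth_collapse N T U t w ^+ n)%:E = (moment lambda n t)%:E)%E.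
Proof.
rewrite le_eqVlt => /predU1P[<-|t0].
  rewrite (ae_eq_integral (cst ((n == 0%N)%:R : R)%:E)) //.
  - rewrite integral_cst //= probability_setT mule1; congr _%:E.
    by case: n => [|n]; rewrite ?moment0 ?momentS0.
  - by apply/measurable_EFinP/measurable_funX; exact: measurable_growth_collapse.
  - apply: filterS counting_ae => w [T1 cnt] _.
    rewrite /growth_collapse (counting_at0 (N := N^~ w) (T := T^~ w)) //.
    by rewrite big_geq // subrr expr0n.
have [C C0 CP] := moment_scheme_cvg lambda_gt0 n (ltW t0).
have [r rE _] := moment_approx n t0 (ltn0Sn 0).
rewrite rE; congr _%:E; apply/eqP; rewrite -subr_eq0 -normr_eq0.
apply/negPn/negP => neq0; have gt0 : 0 < `|r - moment lambda n t|.
  by rewrite lt_neqAle eq_sym neq0 normr_ge0.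
pose B := n%:R * t ^+ n.-1 * t + C.
have [m m0 mB] : exists2 m : nat, (0 < m)%N & B < m%:R * `|r - moment lambda n t|.
  exists (Num.truncn (B / `|r - moment lambda n t|)).+1 => //.
  by rewrite -ltr_pdivrMr // truncnS_gt.
have mR : 0 < m%:R :> R by rewrite ltr0n.
have [r' r'E r'P] := moment_approx n t0 m0.
(* Both are the same integral, which does not depend on the grid. *)
have rr' : r' = r by apply: EFin_inj; rewrite -r'E -rE.
have := CP m m m0 (leqnn m).
rewrite [m%:R * _]mulrC divfK ?gt_eqF // => CPm.
have : `|r - moment lambda n t| <= B / m%:R.
  rewrite /B mulrDl; apply: le_trans (lerD r'P CPm); rewrite rr'.
  by rewrite -[X in `|X|](subrKA (moment_scheme lambda (t / m%:R) m n)) ler_normD.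
by rewrite ler_pdivlMr // leNgt mulrC mB.
Qed.

End growth_collapse_moments.

Theorem proposition5p1 (R : realType) (d : measure_display)
    (Omega : measurableType d) (P : probability Omega R)
    (lambda : R) (N : R -> {RV P >-> nat}) (T U : nat -> {RV P >-> R})
    (lambda_gt0 : 0 < lambda)
    (N_poisson : poisson_process lambda N T)
    (U_iid : iid_uniform01 U)
    (NU_indep : independent_families P
       [set t : R | 0 <= t] (fun t => N t : Omega -> nat)
       [set k : nat | (1 <= k)%N] (fun k => U k : Omega -> R)) :
  (forall (n : nat) (t : R), 0 <= t ->
     ('E_P[(fun w => growth_collapse N T U t w ^+ n)%R])%E =
     ((n.+1)`!%:R / lambda ^+ n *
      \sum_(0 <= k < n.+1)
        (-1) ^+ k * (k.+1%:R : R) ^ (n%:Z - 1) * 'C(n, k)%:R *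
        expR (- (k%:R * lambda * t / k.+1%:R)))%:E) /\
  (forall n : nat, (1 <= n)%N ->
     ('E_P[(fun w => growth_collapse N T U t w ^+ n)%R])%E @[t --> +oo] -->
     ((n.+1)`!%:R / lambda ^+ n)%:E).
Proof.
have momentE n t : 0 <= t ->
    ('E_P[(fun w => growth_collapse N T U t w ^+ n)%R] = (moment lambda n t)%:E)%E.
  by move=> t0; rewrite unlock; exact: growth_collapse_moment.
split=> [|n _]; first exact: momentE.
have : (moment lambda n t)%:E @[t --> +oo] --> ((n.+1)`!%:R / lambda ^+ n)%:E.
  apply: cvg_EFin; first exact: nearW.
  exact: moment_cvgy.
(* The formula is available for t >= 0 only, which holds eventually. *)
apply: cvg_trans; apply: near_eq_cvg; near=> t.
by rewrite momentE.
Unshelve. all: by end_near.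
Qed.
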